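(* Let $G$ be a connected block graph, write $d=d_G$, and let $a,b,c,x,y\in V(G)$ be such that $d(a,b,c)=\operatorname{tr}(G)$ and $d(x,y)=\operatorname{diam}(G)$. Then $$\max\{d(a,b),d(a,c),d(b,c)\}=\operatorname{diam}(G)$$ and $$\max\{d(a,x,y),d(b,x,y),d(c,x,y)\}=\operatorname{tr}(G).$$
   Context: All graphs are finite and simple. For a connected graph $G$, $d_G(u,v)$ denotes the length of a shortest path between $u$ and $v$ in $G$, and $\operatorname{diam}(G)=\max\{d_G(u,v):u,v\in V(G)\}$. For vertices $u,v,w\in V(G)$ put $d_G(u,v,w)=d_G(u,v)+d_G(u,w)+d_G(v,w)$. The triameter of a connected graph $G$ is $\operatorname{tr}(G)=\max\{d_G(u,v,w): u,v,w\in V(G)\}$ (the vertices $u,v,w$ are not required to be distinct). A cut-vertex of a graph is a vertex whose deletion increases the number of connected components; a block of a graph is a maximal connected subgraph that has no cut-vertices of its own. A graph $H$ is called a block graph if it is isomorphic to the intersection graph of the collection of all blocks of some graph; equivalently (a well-known fact), $H$ is a block graph if and only if each block of $H$ is a complete graph. *)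

(* Defs.v *)
From mathcomp Require Import all_boot.

Set Implicit Arguments.
Unset Strict Implicit.
Unset Printing Implicit Defensive.

Record sgraph := SGraph {
  vertex :> finType;
  adj : rel vertex;
  adj_sym : symmetric adj;
  adj_irr : irreflexive adj }.

Definition connected_graph (G : sgraph) : Prop :=
  forall x y : G, connect (@adj G) x y.

Definition isomorphic (G H : sgraph) : Prop :=
  exists f : G -> H, bijective f /\ forall x y, adj (f x) (f y) = adj x y.

Section Distance.
Variable G : sgraph.
Implicit Types u v w : G.

Definition has_path (n : nat) u v : bool :=
  [exists p : n.-tuple G,
    [&& path (@adj G) u p, last u p == v & uniq (u :: p)]].

(* The least n such that some path of length n joins u to v. Such an n is less
   than #|G|, and the value #|G| is only reached when no path joins u to v. *)
Definition dist u v : nat := find (fun n => has_path n u v) (iota 0 #|G|).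

Definition dist3 u v w : nat := dist u v + dist u w + dist v w.

Definition diam : nat := \max_(u : G) \max_(v : G) dist u v.

Definition triam : nat :=
  \max_(u : G) \max_(v : G) \max_(w : G) dist3 u v w.

End Distance.

(* Subgraphs of G are pairs (vertex set, edge set), an edge being an unordered
   pair [set x; y]; they need not be induced. *)
Section Subgraphs.
Variable G : sgraph.

Definition pregraph : finType := ({set G} * {set {set G}})%type.

Implicit Types H K : pregraph.

Definition is_subgraph H : bool :=
  [forall e in H.2, exists x in H.1, exists y in H.1,
    adj x y && (e == [set x; y])].

Definition sub_adj H : rel G := [rel x y | [set x; y] \in H.2].

Definition sub_le H K : bool := (H.1 \subset K.1) && (H.2 \subset K.2).

Definition sub_connected H : bool :=
  (H.1 != set0) && [forall x in H.1, forall y in H.1, connect (sub_adj H) x y].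

Definition components H : nat := n_comp (sub_adj H) H.1.

Definition del_vertex H (v : G) : pregraph :=
  (H.1 :\ v, [set e in H.2 | v \notin e]).

Definition cut_vertex H (v : G) : bool :=
  (v \in H.1) && (components H < components (del_vertex H v)).

Definition nonseparable H : bool :=
  [&& is_subgraph H, sub_connected H & [forall v, ~~ cut_vertex H v]].

Definition is_block H : bool :=
  nonseparable H &&
  [forall K : pregraph, (nonseparable K && sub_le H K) ==> (K == H)].

Definition block : finType := {H : pregraph | is_block H}.

Definition block_adj : rel block :=
  [rel B C | (B != C) && ((val B).1 :&: (val C).1 != set0)].

Lemma block_adj_sym : symmetric block_adj.
Proof. by move=> B C; rewrite /block_adj /= eq_sym setIC. Qed.

Lemma block_adj_irr : irreflexive block_adj.
Proof. by move=> B; rewrite /block_adj /= eqxx. Qed.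

Definition block_intersection_graph : sgraph :=
  SGraph block_adj_sym block_adj_irr.

End Subgraphs.

Definition block_graph (H : sgraph) : Prop :=
  exists G : sgraph, isomorphic H (block_intersection_graph G).

(* Main.v *)
(* Blocks of a graph meet in at most one vertex, and a walk leaving a block can
   only return to it at the vertex it left from, since a block together with a
   path joining two of its vertices is nonseparable. So in the intersection
   graph of the blocks, two neighbours of m joined by a walk avoiding m are
   equal or adjacent. Hence an inner vertex of a geodesic separates its ends,
   and the distance satisfies the four-point condition of tree metrics. Under
   that condition, if x is a vertex farthest from a, one of b, c can be replaced
   by x without decreasing the perimeter of a, b, c; doing this from a and then
   from x brings in a diametral pair. *)
Require Import Defs.
From mathcomp Require Import all_boot zify.

Set Implicit Arguments.
Unset Strict Implicit.
Unset Printing Implicit Defensive.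

(** * Diametral pairs and largest perimeters under the four-point condition *)

Section FourPoint.
Variables (T : Type) (d : T -> T -> nat).
Hypothesis d_sym : forall u v, d u v = d v u.
Hypothesis four_point : forall u v w z,
  d u v + d w z <= maxn (d u w + d v z) (d u z + d v w).

Let perimeter u v w := d u v + d u w + d v w.

(** In the four-point inequality for the pairs [z, u] and [x, y], the terms [d u x] and [d u y] on
    the right are absorbed by [d x y] on the left. *)
Lemma four_point_diametral x y z u :
  (forall u v, d u v <= d x y) -> d z u <= maxn (d z x) (d z y).
Proof.
move=> xy; have := four_point z u x y; have := xy u x; have := xy u y; lia.
Qed.

Lemma four_point_replace a b c x : d a b <= d a x -> d a c <= d a x ->
  perimeter a b c <= maxn (perimeter b a x) (perimeter c a x).
Proof.
move=> ab ac; rewrite /perimeter; have := four_point a x b c.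
have := d_sym a b; have := d_sym a c; have := d_sym b x; have := d_sym c x.
lia.
Qed.

(** Let [x] be the end farther from [a]; it is then farthest from [a], and a replacement at [a]
    brings it in. Since [y] is farthest from [x], a second replacement, at [x], brings in [y]. *)
Lemma four_point_diametral_perimeter x y a b c :
  (forall u v, d u v <= d x y) ->
  perimeter a b c <= maxn (maxn (perimeter a x y) (perimeter b x y)) (perimeter c x y).
Proof.
wlog ayx : x y / d a y <= d a x => [wl xy|xy].
  have permE z : perimeter z x y = perimeter z y x.
    by rewrite /perimeter (d_sym x y); lia.
  case/orP: (leq_total (d a y) (d a x)) => h; first exact: wl.
  by rewrite !permE; apply: wl => // u v; rewrite (d_sym y x).
have far u : d a u <= d a x by have := four_point_diametral a u xy; lia.
have abc := four_point_replace (far b) (far c).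
have xab := four_point_replace (xy x a) (xy x b).
have xac := four_point_replace (xy x a) (xy x c).
have rot z : perimeter z a x = perimeter x a z.
  by rewrite /perimeter (d_sym x a) (d_sym x z) (d_sym a z); lia.
rewrite !rot in abc; lia.
Qed.

(** This serves the first claim: [a] is the vertex of the triple that completes the diametral pair
    to a largest perimeter. *)
Lemma four_point_triametral_distance x y a b c :
  (forall u v, d u v <= d x y) ->
  (forall u v w, perimeter u v w <= perimeter a b c) ->
  perimeter a x y = perimeter a b c ->
  d x y <= maxn (maxn (d a b) (d a c)) (d b c).
Proof.
wlog ayx : x y / d a y <= d a x => [wl xy abc axy|xy abc axy].
  case/orP: (leq_total (d a y) (d a x)) => h; first exact: wl.
  rewrite (d_sym x y); apply: wl => // [u v|]; first by rewrite (d_sym y x).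
  by rewrite -axy /perimeter (d_sym y x); lia.
have far u : d a u <= d a x by have := four_point_diametral a u xy; lia.
wlog bc : b c abc axy / d b c + d a x <= d a b + d c x => [wl|].
  have := four_point b c a x; rewrite leq_max => /orP[h|h].
    by apply: wl => //; rewrite (d_sym a b).
  have E : perimeter a b c = perimeter a c b.
    by rewrite /perimeter (d_sym b c); lia.
  rewrite (d_sym b c) (maxnC (d a b) (d a c)); apply: wl; rewrite -?E //.
  by rewrite (d_sym c b) (d_sym a c); lia.
(* Maximality against [a, c, x], added to [bc], forces [d a b = d a x] and [d b c = d c x]. By the
   four-point condition on [x, y, a, b], either [d b y = d x y], or [d a y = d a b] and
   [d b x = d x y]. The conditions involving [c] then give [d x y <= d a b] or [d x y <= d b c]. *)
have abx := abc a b x; have bcx := abc a c x.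
have bxya := four_point x y a b; have cxya := four_point x y a c.
have bcya := four_point b y a c; have bcy := abc b c y; have aby := abc a b y.
have := d_sym b a; have := d_sym c a; have := d_sym y a; have := d_sym x a.
have := d_sym y b; have := d_sym y c; have := d_sym x b; have := d_sym x c.
have := d_sym c b; move: (xy b y) (xy c y) (far b) (far c).
rewrite /perimeter in axy abx bcx bcy aby *.
lia.
Qed.
End FourPoint.

(** * Graph distance as a metric *)

Section Distances.
Variable G : sgraph.
Implicit Types u v w m : G.

Lemma dist_le_size u p : path (@adj G) u p -> dist u (last u p) <= size p.
Proof.
(* A path without repetition has length below [#|G|], so it lies in the range searched by [find]. *)
case/shortenP=> q pq uq sub; apply: leq_trans (uniq_leq_size _ sub); last first.
  by case/andP: uq.
have sq : size q < #|G| by rewrite -[(size q).+1]/(size (u :: q)) -(card_uniqP uq) max_card.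
rewrite leqNgt; apply/negP=> /(before_find 0).
rewrite nth_iota // add0n /has_path => /negbT/negP; apply.
by apply/existsP; exists (in_tuple q); rewrite pq eqxx.
Qed.

Hypothesis Gconn : connected_graph G.

Lemma dist_path u v :
  exists p, [/\ path (@adj G) u p, last u p = v & size p = dist u v].
Proof.
have hasP : has (fun n => has_path n u v) (iota 0 #|G|).
  have /connectP[p0 p0p] := Gconn u v.
  case: (shortenP p0p) => p pp up _ vE.
  apply/hasP; exists (size p).
    by rewrite mem_iota add0n -[(size p).+1]/(size (u :: p)) -(card_uniqP up) max_card.
  by rewrite /has_path; apply/existsP; exists (in_tuple p); rewrite pp -vE eqxx.
have /existsP[p /and3P[pp /eqP lp _]] := nth_find 0 hasP.
exists p; split=> //; rewrite size_tuple nth_iota //.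
by move: hasP; rewrite has_find size_iota.
Qed.

Lemma dist0 u : dist u u = 0.
Proof. by have := @dist_le_size u [::] isT; rewrite leqn0 => /eqP. Qed.

Lemma dist_eq0 u v : dist u v = 0 -> u = v.
Proof. by have [[|z p] [_ /= uv <-]] := dist_path u v. Qed.

Lemma dist_adj u v : adj u v -> dist u v <= 1.
Proof. by move=> uv; apply: (@dist_le_size u [:: v]); rewrite /= uv. Qed.

Lemma dist_triangle v u w : dist u w <= dist u v + dist v w.
Proof.
have [p [pp pv <-]] := dist_path u v; have [q [qp <- <-]] := dist_path v w.
by rewrite -size_cat -pv -last_cat dist_le_size // cat_path pp pv.
Qed.

Lemma dist_le_sym u v : dist u v <= dist v u.
Proof.
have [p [pp <- <-]] := dist_path v u.
have lr : last (last v p) (rev (belast v p)) = v.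
  by case: (p) => //= z q; rewrite rev_cons last_rcons.
rewrite -{2}lr -[in leqRHS](size_belast v p) -(size_rev (belast v p)).
apply: dist_le_size; rewrite rev_path.
by rewrite (eq_path (e' := @adj G)) // => x y; rewrite adj_sym.
Qed.

Lemma dist_sym u v : dist u v = dist v u.
Proof. by apply/eqP; rewrite eqn_leq !dist_le_sym. Qed.

Lemma dist_step u v n :
  dist u v = n.+1 -> exists2 m, adj u m & dist m v = n.
Proof.
have [p [+ + pn] uv] := dist_path u v; rewrite uv in pn.
case: p pn => //= m p [pn] /andP[um mp] pv; exists m => //.
have := dist_triangle m u v; have := dist_adj um; have := dist_le_size mp.
by rewrite pv; lia.
Qed.

Lemma dist_le_diam u v : dist u v <= diam G.
Proof.
apply: leq_trans (leq_bigmax u).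
exact: (@leq_bigmax _ (fun z => dist u z) v).
Qed.

Lemma dist3_le_triam u v w : dist3 u v w <= triam G.
Proof.
apply: leq_trans (leq_bigmax u).
apply: leq_trans (@leq_bigmax _ (fun z => \max_t dist3 u z t) v).
exact: (@leq_bigmax _ (fun z => dist3 u v z) w).
Qed.

End Distances.

(** * Graphs with complete blocks satisfy the four-point condition *)

Definition avoid (G : sgraph) (m : G) : rel G :=
  [rel u v | [&& adj u v, u != m & v != m]].

(* Says that every block of G is complete, without mentioning blocks. *)
Definition clique_blocks (G : sgraph) : Prop :=
  forall m u v : G, adj m u -> adj m v -> connect (avoid m) u v ->
    u = v \/ adj u v.

Section CliqueBlocks.
Variable G : sgraph.
Hypothesis Gconn : connected_graph G.
Hypothesis Gclique : clique_blocks G.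
Implicit Types u v w m : G.

Lemma avoid_sym m : symmetric (avoid m).
Proof.
by move=> u v; rewrite /avoid /= adj_sym [(u != m) && _]andbC.
Qed.

Lemma connect_avoid_sym m : connect_sym (avoid m).
Proof. exact/sym_connect_sym/avoid_sym. Qed.

Lemma dist_clique m u v :
  adj m u -> adj m v -> connect (avoid m) u v -> dist u v <= 1.
Proof.
move=> mu mv /(Gclique mu mv)[->|]; first by rewrite dist0.
exact: dist_adj.
Qed.

(* A geodesic from u to w cannot meet m. *)
Lemma connect_avoid_geodesic m u w :
  dist u w < dist u m + dist m w -> connect (avoid m) u w.
Proof.
move E: (dist u w) => n; elim: n u E => [|n IH] u uw lt.
  by rewrite (dist_eq0 Gconn uw).
have um : u != m by apply: contraTneq lt => <-; rewrite dist0 uw; lia.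
have [v uv vw] := dist_step Gconn uw.
have := dist_triangle Gconn v u m; have := dist_adj uv => d1 tr.
have vm : v != m by apply: contraTneq lt => E; move: vw d1; rewrite E; lia.
apply: connect_trans (IH v vw _); last by lia.
by apply: connect1; rewrite /avoid /= uv um vm.
Qed.

(* Every inner vertex m of a geodesic from u to v separates u from v. *)
Lemma dist_through m u v w : adj u m -> dist u v = (dist m v).+1 -> m != v ->
  dist u w = (dist m w).+1 \/ dist v w = dist v m + dist m w.
Proof.
move=> um uv mv.
have [k mvk] : exists k, dist m v = k.+1.
  case E: (dist m v) => [|k]; last by exists k.
  by rewrite (dist_eq0 Gconn E) eqxx in mv.
have [p mp pv] := dist_step Gconn mvk.
have := dist_adj um; have := dist_adj mp => mp1 um1.
have tu := dist_triangle Gconn m u w; have tv := dist_triangle Gconn m v w.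
have tp := dist_triangle Gconn m v p; have tup := dist_triangle Gconn p u v.
have svm := dist_sym Gconn v m; have svp := dist_sym Gconn v p.
have u0 : 0 < dist u m.
  by have := dist_triangle Gconn m u v; lia.
have m0 : 0 < dist m p.
  by have := dist_triangle Gconn p m v; lia.
case: (ltnP (dist u w) (dist u m + dist m w)) => [uw|]; last by left; lia.
case: (ltnP (dist v w) (dist v m + dist m w)) => [vw|]; last by right; lia.
(* If both alternatives fail, geodesics avoiding [m] lead from [u] to [w], from [w] to [v] and from
   [v] to [p], the vertex after [m] on the way to [v]. So the neighbours [u] and [p] of [m] are at
   distance at most 1, too close for [dist u v = dist p v + 2]. *)
suff : dist u p <= 1 by lia.
apply: (@dist_clique m) => //; first by rewrite adj_sym.
apply: connect_trans (connect_avoid_geodesic uw) _.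
rewrite connect_avoid_sym.
apply: connect_trans (_ : connect _ p v) _; last exact: connect_avoid_geodesic.
rewrite connect_avoid_sym; apply: connect_avoid_geodesic; lia.
Qed.

(** Take [p] next after [u] on a geodesic to [w]. The neighbours [v] and [p] of [u] are joined
    through [w] by geodesics avoiding [u], so they are equal or adjacent; their distances to [w]
    differ. *)
Lemma common_neighbour u v w n : adj u v -> dist u w = n.+1 -> dist v w = n.+1 ->
  exists p, [/\ adj u p, adj v p & dist p w = n].
Proof.
move=> uv uw vw; have [p up pw] := dist_step Gconn uw.
have uv1 := dist_adj uv; have up1 := dist_adj up.
have vu1 : dist v u <= 1 by rewrite dist_sym.
have u0 z : adj u z -> 0 < dist z u.
  move=> uz; rewrite lt0n; apply: contraTneq uz => /(dist_eq0 Gconn) ->.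
  by rewrite adj_irr.
have := u0 _ uv; have := u0 _ up => up0 uv0.
exists p; split=> //; case: (@Gclique u v p) => //; last first.
  by move=> E; rewrite E pw in vw; lia.
apply: connect_trans (_ : connect _ v w) _.
  by apply: connect_avoid_geodesic; lia.
by rewrite connect_avoid_sym; apply: connect_avoid_geodesic; lia.
Qed.

(** Induction on [dist u v]. Distances 0 and 1 are treated directly; a longer geodesic is split at
    its second vertex. *)
Lemma dist_four_point u v w z :
  dist u v + dist w z <= maxn (dist u w + dist v z) (dist u z + dist v w).
Proof.
have [n] := ubnP (dist u v); elim: n u v w z => // n IH u v w z.
rewrite ltnS => uvn.
have [wu zu] := (dist_sym Gconn w u, dist_sym Gconn z u).
have [wv zv] := (dist_sym Gconn w v, dist_sym Gconn z v).
have [uwz vwz] := (dist_triangle Gconn u w z, dist_triangle Gconn v w z).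
case uv: (dist u v) => [|[|k]]; rewrite uv in uvn.
- by rewrite -(dist_eq0 Gconn uv); lia.
- have [p up pv] := dist_step Gconn uv; rewrite (dist_eq0 Gconn pv) in up.
  have vu1 : dist v u <= 1 by rewrite dist_sym // uv.
  have tuw := dist_triangle Gconn v u w; have tvw := dist_triangle Gconn u v w.
  have tuz := dist_triangle Gconn v u z; have tvz := dist_triangle Gconn u v z.
  case: (ltngtP (dist u w) (dist v w)) => ew; try lia.
  case: (ltngtP (dist u z) (dist v z)) => ez; try lia.
  case ew0: (dist u w) => [|i].
    by have := dist_triangle Gconn w u v; lia.
  case ez0: (dist u z) => [|j].
    by have := dist_triangle Gconn z u v; lia.
  rewrite ew0 in ew; rewrite ez0 in ez.
  (* Here [w] and [z] are each equidistant from [u] and [v]. The steps [q] and [r] towards them are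
     joined through [v] off [u], which shortens the walk from [w] to [z] via [u] by one. *)
  have [q [uq vq qw]] := common_neighbour up ew0 (esym ew).
  have [r [ur vr rz]] := common_neighbour up ez0 (esym ez).
  have qr : dist q r <= 1.
    have uv' : v != u by apply: contraTneq up => ->; rewrite adj_irr.
    have nu t : adj u t -> t != u by apply: contraTneq => ->; rewrite adj_irr.
    apply: (@dist_clique u) => //; apply: (connect_trans (y := v)).
      by apply: connect1; rewrite /avoid /= adj_sym vq uv' nu.
    by apply: connect1; rewrite /avoid /= vr uv' nu.
  have := dist_triangle Gconn q w z; have := dist_triangle Gconn r q z.
  have := dist_sym Gconn w q; lia.
- have [m um mv] := dist_step Gconn uv.
  have mv' : m != v by apply/eqP=> E; rewrite E dist0 in mv.
  (* If [m] separates [u] from both [w] and [z], induction for [m, v] applies; if it separates [v]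
     from both, induction for [u, m]. In the mixed case the triangle inequality through [m]
     suffices. *)
  have := dist_through (v := v) w um; have := dist_through (v := v) z um.
  rewrite uv mv => /(_ erefl mv') hz /(_ erefl mv') hw.
  have vm := dist_sym Gconn v m; have um1 := dist_adj um.
  have ihv : dist m v < n by lia.
  have ihu : dist u m < n by lia.
  have := IH m v w z ihv; have := IH u m w z ihu.
  have tmw := dist_triangle Gconn m w z; have wm := dist_sym Gconn w m.
  have tuv := dist_triangle Gconn m u v.
  by case: hw => hw; case: hz => hz; lia.
Qed.

Lemma clique_blocks_triameter (a b c x y : G) :
  dist3 a b c = triam G -> dist x y = diam G ->
  maxn (maxn (dist a b) (dist a c)) (dist b c) = diam G
  /\ maxn (maxn (dist3 a x y) (dist3 b x y)) (dist3 c x y) = triam G.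
Proof.
move=> habc hxy.
have dxy u v : dist u v <= dist x y by rewrite hxy dist_le_diam.
have tabc u v w : dist3 u v w <= dist3 a b c by rewrite habc dist3_le_triam.
have sym := dist_sym Gconn; have fp := dist_four_point.
have far : dist3 a b c <= maxn (maxn (dist3 a x y) (dist3 b x y)) (dist3 c x y).
  exact: four_point_diametral_perimeter sym fp x y a b c dxy.
(* The triple is permuted so that the vertex forming a triametral triple with [x, y] comes first. *)
have diametral (p q r : G) : dist3 p q r = dist3 a b c -> 
    dist3 p x y = dist3 a b c ->
    dist x y <= maxn (maxn (dist p q) (dist p r)) (dist q r).
  move=> pqr pxy; apply: (four_point_triametral_distance sym fp dxy).
    by move=> u v w; apply: leq_trans (tabc u v w) _; rewrite -pqr.
  by rewrite -/(dist3 p x y) pxy -pqr.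
rewrite -habc -hxy; split; apply/eqP; rewrite eqn_leq; last first.
  by rewrite !geq_max !tabc.
rewrite !geq_max !dxy /=; move: far; rewrite !leq_max -orbA => /or3P[] far.
- have := diametral a b c erefl; rewrite !leq_max; apply.
  by apply/eqP; rewrite eqn_leq tabc.
- have := diametral b a c; rewrite [dist3 b a c]/dist3 (sym b a) => h.
  by have := h _ _; rewrite /dist3 in far tabc *; have := tabc b x y; lia.
- have := diametral c a b; rewrite [dist3 c a b]/dist3 (sym c a) (sym c b) => h.
  by have := h _ _; rewrite /dist3 in far tabc *; have := tabc c x y; lia.
Qed.

End CliqueBlocks.

(** * Blocks of a graph and their intersection graph *)

Section Blocks.
Variable G : sgraph.
Implicit Types (K L : pregraph G) (u v w x y z s t : G).

Lemma subgraph_edge K x y : is_subgraph K -> sub_adj K x y ->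
  [/\ adj x y, x \in K.1 & y \in K.1].
Proof.
move=> /forall_inP sK /= /sK /exists_inP[x' Kx' /exists_inP[y' Ky' /andP[xy' /eqP E]]].
have: x \in [set x'; y'] by rewrite -E !inE eqxx.
have: y \in [set x'; y'] by rewrite -E !inE eqxx orbT.
have: x' \in [set x; y] by rewrite E !inE eqxx.
have: y' \in [set x; y] by rewrite E !inE eqxx orbT.
have ne : x' != y' by apply: contraTneq xy' => ->; rewrite adj_irr.
rewrite !inE => /orP[]/eqP Ey /orP[]/eqP Ex _ _; subst; rewrite ?eqxx // in ne *.
by split=> //; rewrite adj_sym.
Qed.

Lemma is_subgraphP K : (forall e, e \in K.2 ->
    exists x y, [/\ x \in K.1, y \in K.1, adj x y & e = [set x; y]]) ->
  is_subgraph K.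
Proof.
move=> sK; apply/forall_inP=> e /sK[x [y [Kx Ky xy ->]]].
by apply/exists_inP; exists x => //; apply/exists_inP; exists y; rewrite // xy eqxx.
Qed.

Lemma sub_adj_sym K : connect_sym (sub_adj K).
Proof. by apply: sym_connect_sym => x y; rewrite /sub_adj /= setUC. Qed.

Lemma sub_adj_mono K L x y : K.2 \subset L.2 ->
  connect (sub_adj K) x y -> connect (sub_adj L) x y.
Proof.
move=> sKL; apply: connect_sub => u v /= uv; apply: connect1.
exact: (subsetP sKL).
Qed.

Lemma connect_subgraph K x y : is_subgraph K -> connect (sub_adj K) x y ->
  x \in K.1 -> y \in K.1.
Proof.
move=> sK /connectP[p + ->]; elim: p x => //= z p IH x /andP[xz zp] _.
by apply: IH => //; case: (subgraph_edge sK xz).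
Qed.

Lemma del_vertex_subgraph K w : is_subgraph K -> is_subgraph (del_vertex K w).
Proof.
move=> sK; apply: is_subgraphP => e; rewrite inE => /andP[].
move/forall_inP: (sK) => /[apply] /exists_inP[x Kx /exists_inP[y Ky]].
case/andP=> xy /eqP->; rewrite !inE negb_or => /andP[wx wy].
by exists x, y; rewrite !inE !(eq_sym _ w) wx wy.
Qed.

Lemma del_vertex_mono K L w : K.2 \subset L.2 ->
  (del_vertex K w).2 \subset (del_vertex L w).2.
Proof.
by move=> /subsetP s; apply/subsetP=> e; rewrite !inE => /andP[/s-> ->].
Qed.

(** [n_comp] counts canonical roots. Edges of a subgraph have both ends in it, so the root of a
    vertex of [K] lies in [K]. *)
Lemma components_le1P K : is_subgraph K ->
  reflect {in K.1 &, forall x y, connect (sub_adj K) x y} (components K <= 1).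
Proof.
move=> sK; have rK x : x \in K.1 -> root (sub_adj K) x \in K.1.
  by apply: connect_subgraph => //; apply: connect_root.
have rr x : x \in K.1 ->
    root (sub_adj K) x \in predI (roots (sub_adj K)) (mem K.1).
  by move=> Kx; rewrite inE /= rK // andbT; apply/roots_root/sub_adj_sym.
apply: (iffP card_le1_eqP) => [c x y Kx Ky | c x y].
  by rewrite -root_connect ?(c _ _ (rr x Kx) (rr y Ky)) //; exact: sub_adj_sym.
rewrite !inE => /andP[/eqP rx Kx] /andP[/eqP ry Ky].
rewrite -rx -ry; apply/eqP; rewrite root_connect; last exact: sub_adj_sym.
exact: c.
Qed.

Lemma components_gt0 K x : is_subgraph K -> x \in K.1 -> 0 < components K.
Proof.
move=> sK Kx; apply/card_gt0P; exists (root (sub_adj K) x).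
rewrite inE /= (connect_subgraph sK (connect_root _ _)) // andbT.
exact/roots_root/sub_adj_sym.
Qed.

Lemma nonseparable_del K w : nonseparable K ->
  {in K.1 :\ w &, forall x y, connect (sub_adj (del_vertex K w)) x y}.
Proof.
case/and3P=> sK /andP[_ /forall_inP cK] /forallP/(_ w).
have K1 : components K <= 1.
  by apply/(components_le1P sK)=> x y Kx Ky; move/forall_inP: (cK x Kx) => /(_ y Ky).
case wK : (w \in K.1); rewrite /cut_vertex wK /= => cut.
  by apply/(components_le1P (del_vertex_subgraph w sK)); lia.
(* When [w] is outside [K], no edge of [K] contains it and the deletion keeps every edge. *)
move=> x y; rewrite !inE => /andP[_ Kx] /andP[_ Ky].
apply: sub_adj_mono (forall_inP (cK x Kx) y Ky).
apply/subsetP=> e Ke; rewrite inE Ke /=; apply: contraFN wK.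
move/forall_inP: sK => /(_ e Ke) /exists_inP[u Ku /exists_inP[v Kv]].
by case/andP=> _ /eqP->; rewrite !inE => /orP[]/eqP->.
Qed.

Lemma nonseparable_connect K : nonseparable K ->
  {in K.1 &, forall x y, connect (sub_adj K) x y}.
Proof.
case/and3P=> _ /andP[_ /forall_inP cK] _ x y Kx.
by move/forall_inP: (cK x Kx); apply.
Qed.

(* Any two vertices of U can be joined inside U - w through K - w. *)
Lemma block_maximal K U s t :
  is_block K -> is_subgraph U -> sub_le K U ->
  s \in K.1 -> t \in K.1 -> s != t ->
  (forall w x, x \in U.1 -> x != w ->
     exists2 z, z \in K.1 :\ w & connect (sub_adj (del_vertex U w)) x z) ->
  U = K.
Proof.
case/andP=> nK /forallP/(_ U) maxK sU KU Ks Kt st att.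
apply/eqP; move: maxK; rewrite KU andbT => /implyP; apply.
have /andP[_ KU2] := KU.
have delU w : {in U.1 :\ w &, forall x y, connect (sub_adj (del_vertex U w)) x y}.
  move=> x y; rewrite !inE => /andP[xw Ux] /andP[yw Uy].
  have [x' Kx' xx'] := att w x Ux xw; have [y' Ky' yy'] := att w y Uy yw.
  apply: connect_trans xx' (connect_trans _ _); last by rewrite sub_adj_sym; exact: yy'.
  exact: sub_adj_mono (del_vertex_mono w KU2) (nonseparable_del nK Kx' Ky').
have cU : {in U.1 &, forall x y, connect (sub_adj U) x y}.
  have toK x : x \in U.1 -> exists2 z, z \in K.1 & connect (sub_adj U) x z.
    (* [att] needs a deleted vertex other than [x]; one of [s], [t] serves. *)
    move=> Ux; have [w xw] : exists w, x != w.
      by case: (eqVneq x s) => [->|]; [exists t | exists s].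
    have [z + xz] := att w x Ux xw; rewrite inE => /andP[_ Kz]; exists z => //.
    by apply: sub_adj_mono xz; apply/subsetP=> e; rewrite inE => /andP[].
  move=> x y /toK[x' Kx' xx'] /toK[y' Ky' yy'].
  apply: connect_trans xx' (connect_trans _ _); last by rewrite sub_adj_sym; exact: yy'.
  exact: sub_adj_mono KU2 (nonseparable_connect nK Kx' Ky').
have Us : s \in U.1 by case/andP: KU => /subsetP-> .
apply/and3P; split=> //.
  apply/andP; split; first by apply/set0Pn; exists s.
  by apply/forall_inP=> x Ux; apply/forall_inP=> y Uy; exact: cU.
apply/forallP=> w; rewrite /cut_vertex negb_and -leqNgt; apply/orP; right.
apply: leq_trans (components_gt0 sU Us).
exact/(components_le1P (del_vertex_subgraph w sU))/delU.
Qed.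

Definition sub_union K L : pregraph G := (K.1 :|: L.1, K.2 :|: L.2).

Lemma sub_union_subgraph K L :
  is_subgraph K -> is_subgraph L -> is_subgraph (sub_union K L).
Proof.
move=> /forall_inP sK /forall_inP sL; apply: is_subgraphP => e; rewrite inE.
case/orP=> [/sK|/sL] /exists_inP[x Kx /exists_inP[y Ky /andP[xy /eqP->]]];
  by exists x, y; rewrite !inE Kx Ky ?orbT.
Qed.

Lemma sub_le_unionl K L : sub_le K (sub_union K L).
Proof. by rewrite /sub_le !subsetUl. Qed.

Lemma sub_le_unionr K L : sub_le L (sub_union K L).
Proof. by rewrite /sub_le !subsetUr. Qed.

Lemma block_union K L s t : is_block K -> is_subgraph L ->
  s \in K.1 -> t \in K.1 -> s != t ->
  (forall w x, x \in L.1 -> x != w ->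
     exists2 z, z \in K.1 :\ w & connect (sub_adj (del_vertex L w)) x z) ->
  sub_le L K.
Proof.
move=> bK sL Ks Kt st att.
have sK : is_subgraph K by case/andP: bK => /and3P[].
rewrite -[in sub_le L _](block_maximal bK (sub_union_subgraph sK sL) _ Ks Kt st).
- exact: sub_le_unionr.
- exact: sub_le_unionl.
move=> w x; rewrite inE => /orP[Kx|Lx] xw.
  by exists x; [rewrite !inE xw | exact: connect0].
have [z Kz xz] := att w x Lx xw; exists z => //.
by apply: sub_adj_mono xz; apply/del_vertex_mono/subsetUr.
Qed.

(** Whatever vertex [w] is deleted, [s] or [t] survives, and the rest of [L] is connected to it. So
    [K] absorbs [L], and maximality of [L] gives equality. *)
Lemma block_eq K L s t : is_block K -> is_block L -> s != t ->
  s \in K.1 -> t \in K.1 -> s \in L.1 -> t \in L.1 -> K = L.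
Proof.
move=> bK bL st Ks Kt Ls Lt.
have /andP[nL /forallP/(_ K) maxL] := bL; have /andP[nK _] := bK.
suff LK : sub_le L K by apply/eqP; move: maxL; rewrite nK LK.
apply: (block_union bK _ Ks Kt st); first by case/and3P: nL.
move=> w x Lx xw.
have [z zw [Kz Lz]] : exists2 z, z != w & z \in K.1 /\ z \in L.1.
  by case: (eqVneq s w) => [<-|]; [exists t; first rewrite eq_sym | exists s].
by exists z; rewrite ?(nonseparable_del nL) // !inE ?zw ?xw.
Qed.

Fixpoint path_edges s (p : seq G) : {set {set G}} :=
  if p is y :: p' then [set s; y] |: path_edges y p' else set0.

Definition path_subgraph s (p : seq G) : pregraph G :=
  ([set x in s :: p], path_edges s p).

Lemma is_subgraph_path s p :
  path (@adj G) s p -> is_subgraph (path_subgraph s p).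
Proof.
elim: p s => [|y p IH] s /=; first by move=> _; apply: is_subgraphP => e; rewrite inE.
case/andP=> sy /IH /forall_inP yp; apply: is_subgraphP => e; rewrite !inE.
case/orP=> [/eqP->|/yp]; first by exists s, y; rewrite !inE !eqxx !orbT.
case/exists_inP=> x + /exists_inP[z + /andP[xz /eqP->]]; rewrite !inE => px pz.
by exists x, z; rewrite !inE px pz !orbT.
Qed.

Lemma path_subgraph_last w s p x : w \notin s :: p -> x \in s :: p ->
  connect (sub_adj (del_vertex (path_subgraph s p) w)) x (last s p).
Proof.
elim: p s x => [|y p IH] s x /=; first by rewrite !inE => _ /eqP->.
rewrite inE negb_or => /andP[ws wyp].
have mono a b : connect (sub_adj (del_vertex (path_subgraph y p) w)) a b ->
    connect (sub_adj (del_vertex (path_subgraph s (y :: p)) w)) a b.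
  by apply/sub_adj_mono/del_vertex_mono/subsetUr.
rewrite inE => /orP[/eqP->|xyp]; last exact/mono/IH.
apply: connect_trans (mono _ _ (IH y y wyp (mem_head _ _))).
apply: connect1; rewrite /sub_adj /= !inE eqxx negb_or ws /=.
by move: wyp; rewrite inE negb_or => /andP[].
Qed.

(** A simple path meets [w] at most once, so each piece left by the deletion keeps an end of the
    path. *)
Lemma path_subgraph_ends w s p x : uniq (s :: p) -> x \in s :: p -> x != w ->
  let c := connect (sub_adj (del_vertex (path_subgraph s p) w)) x in
  (s != w) && c s || (last s p != w) && c (last s p).
Proof.
elim: p s => [|y p IH] s /=; first by rewrite inE => _ /eqP-> ->; rewrite connect0.
case/andP=> sp uyp.
have mono a b : connect (sub_adj (del_vertex (path_subgraph y p) w)) a b ->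
    connect (sub_adj (del_vertex (path_subgraph s (y :: p)) w)) a b.
  by apply/sub_adj_mono/del_vertex_mono/subsetUr.
rewrite inE => /orP[/eqP-> ->|xyp xw]; first by rewrite connect0.
case: (eqVneq s w) => [E|sw] /=.
  rewrite -E in mono *; rewrite mono ?path_subgraph_last // andbT.
  by apply: contraNneq sp => <-; rewrite mem_last.
case/orP: (IH y uyp xyp xw) => /andP[ne /mono xc]; last by rewrite ne xc orbT.
rewrite (connect_trans xc) //; apply: connect1.
by rewrite /sub_adj /= !inE setUC eqxx negb_or !(eq_sym w) sw ne.
Qed.

Lemma path_in_block K s p : is_block K -> path (@adj G) s p -> uniq (s :: p) ->
  s \in K.1 -> last s p \in K.1 -> s != last s p -> path_edges s p \subset K.2.
Proof.
move=> bK sp up Ks Kl ne.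
suff /andP[_] : sub_le (path_subgraph s p) K by [].
apply: (block_union bK (is_subgraph_path sp) Ks Kl ne) => w x.
rewrite inE => px xw.
by case/orP: (path_subgraph_ends up px xw) => /andP[zw xz];
  [exists s | exists (last s p)]; rewrite // !inE zw.
Qed.

(** Leaving [K] is measured by edges, since a walk outside the block may still visit its
    vertices. *)
Definition off_block K : rel G :=
  [rel x y | adj x y && ([set x; y] \notin K.2)].

(** With distinct ends, the shortened walk would have all its edges in [K] by [path_in_block], yet
    its first edge is off [K]. *)
Lemma off_block_separated K s t : is_block K -> s \in K.1 -> t \in K.1 ->
  connect (off_block K) s t -> s = t.
Proof.
move=> bK Ks Kt /connectP[p0 p0p tE]; move: tE Kt; case: (shortenP p0p) => p pp up _ -> Kt.
case: (eqVneq s (last s p)) => // ne.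
have adjp : path (@adj G) s p by apply: sub_path pp => x y /andP[].
have := path_in_block bK adjp up Ks Kt ne.
case: p pp {up Kt adjp} ne => [|y p] /=; first by rewrite eqxx.
by case/andP=> /andP[_ /negP ns] _ _ /subsetP/(_ [set s; y]); rewrite !inE eqxx => /(_ isT).
Qed.

(** Distinct blocks share no edge, by [block_eq] at its two ends, so connections inside [L] are off
    [K]. *)
Lemma connect_off_block K L x y : is_block K -> is_block L -> L != K ->
  x \in L.1 -> y \in L.1 -> connect (off_block K) x y.
Proof.
move=> bK bL LK Lx Ly; have nL : nonseparable L by case/andP: bL.
have sL : is_subgraph L by case/and3P: nL.
have sK : is_subgraph K by case/andP: bK => /and3P[].
apply: connect_sub (nonseparable_connect nL Lx Ly) => u v uv; apply: connect1.
have [auv Lu Lv] := subgraph_edge sL uv; rewrite /off_block /= auv /=.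
apply: contraNN LK => /(subgraph_edge sK)[_ Ku Kv]; apply/eqP.
apply: block_eq bL bK _ Lu Lv Ku Kv.
by apply: contraTneq auv => ->; rewrite adj_irr.
Qed.

Lemma avoid_off_block (M B C : block_intersection_graph G) x y :
  B != M -> connect (avoid M) B C ->
  x \in (val B).1 -> y \in (val C).1 -> connect (off_block (val M)) x y.
Proof.
move=> + /connectP[p + ->]; elim: p B x => [|D p IH] B x /= BM.
  by move=> _; apply: connect_off_block (valP M) (valP B) BM.
case/andP=> /and3P[BD _ DM] Dp Bx Ly.
have /andP[_ /set0Pn[z]] := BD; rewrite inE => /andP[Bz Dz].
apply: connect_trans (IH D z DM Dp Dz Ly).
exact: connect_off_block (valP M) (valP B) BM Bx Bz.
Qed.

(** Let [M] meet [B] in [s] and [C] in [t]. The chain of blocks from [B] to [C] joins [s] to [t] off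
    [M], so [s = t] is common to [B] and [C]. *)
Lemma block_intersection_clique_blocks :
  clique_blocks (block_intersection_graph G).
Proof.
move=> M B C MB MC BC; case: (eqVneq B C) => [|ne]; [by left | right].
have /andP[MB' /set0Pn[s]] := MB; rewrite inE => /andP[Ms Bs].
have /andP[_ /set0Pn[t]] := MC; rewrite inE => /andP[Mt Ct].
have BM : B != M by rewrite eq_sym.
have E := off_block_separated (valP M) Ms Mt (avoid_off_block BM BC Bs Ct).
apply/andP; split; first exact: ne.
apply/set0Pn; exists s; rewrite in_setI Bs.
by rewrite E.
Qed.

End Blocks.

(** * Transfer along isomorphisms and conclusion *)

Lemma isomorphic_clique_blocks (G H : sgraph) :
  isomorphic G H -> clique_blocks H -> clique_blocks G.
Proof.
move=> [f [/bij_inj injf adjf]] cH m u v mu mv uv.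
case: (cH (f m) (f u) (f v)); rewrite ?adjf //; last by right.
- case/connectP: uv => p up ->; apply/connectP; exists (map f p).
    by rewrite path_map; apply: sub_path up => x y; rewrite /avoid /= adjf !(inj_eq injf).
  by rewrite last_map.
- by move/injf; left.
Qed.

Theorem theorem1p2 (G : sgraph) (Gconn : connected_graph G)
    (Gblock : block_graph G) (a b c x y : G)
    (habc : dist3 a b c = triam G) (hxy : dist x y = diam G) :
  maxn (maxn (dist a b) (dist a c)) (dist b c) = diam G
  /\ maxn (maxn (dist3 a x y) (dist3 b x y)) (dist3 c x y) = triam G.
Proof.
have [G0 iso] := Gblock.
apply: clique_blocks_triameter => //.
exact: isomorphic_clique_blocks iso (@block_intersection_clique_blocks G0).
Qed.
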